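(* Let $K\ge 1$ be an integer, let $\{a_k\}_k\subseteq\mathbb{R}$, $\{b_k\}_k\subseteq\mathbb{R}$ and functions $s,t:\mathbb{R}\to\mathbb{R}$ be given. Assume that $$a_{k+1}\le\Big(1-\frac{1}{s(b_k)}\Big)a_k+\frac{1}{t(b_k)}\qquad\text{for all }k\in[K],$$ and that there is an interval $I$ such that $b_k\in I$ for all $k\in[K]$, $s(x)\ge 1$ and $t(x)>0$ for all $x\in I$, and $r:=s/t$ is convex on $I$. Suppose that at least one of the following holds: (a) There exist subgradients $g_k\in\partial r(b_k)$ and a non-decreasing sequence $\{\lambda_k\}_k\subseteq\mathbb{R}_{++}$ such that for all $k\in[K-1]$, $$(b_{k+1}-b_k)\cdot g_k\,t(b_k)\ge -1+\frac{1}{\lambda_{k+1}}.$$ (b) The function $r$ is differentiable on $I$ and, with $u:=(\log r)'s=r't$, there exists a non-decreasing sequence $\{\lambda_k\}_k\subseteq\mathbb{R}_{++}$ such that for all $k\in[K-1]$, $$(b_{k+1}-b_k)\cdot u(b_k)\ge -1+\frac{1}{\lambda_{k+1}}.$$ Then $$a_{k+1}\le\lambda_{k+1}r(b_{k+1})+\big(a_0-\lambda_0 r(b_0)\big)\prod_{i=0}^{k}\Big(1-\frac{1}{s(b_i)}\Big)\qquad\text{for all }k\in[K-1].$$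
   Context: $[K]:=\{0,1,\dots,K\}$, $\mathbb{R}_{++}:=(0,\infty)$. $\partial r(b)$ is the convex subdifferential of $r$ on $I$: $g\in\partial r(b)$ means $r(y)\ge r(b)+g(y-b)$ for all $y\in I$. *)

(* Defs.v *)
From mathcomp Require Import all_boot all_order all_algebra.
From mathcomp Require Import all_classical all_reals all_analysis.
Set Implicit Arguments.
Unset Strict Implicit.
Unset Printing Implicit Defensive.
Import Order.TTheory GRing.Theory Num.Theory.
Import numFieldNormedType.Exports.
Local Open Scope classical_set_scope.
Local Open Scope ring_scope.

Definition subdifferential (R : realType) (I : set R) (r : R -> R) (x : R) :
    set R :=
  [set g | forall y, I y -> r x + g * (y - x) <= r y].

(* The limit ranges over the y in I other than x, so differentiability on I is
   one-sided at an endpoint of I belonging to I, and the values of f outside I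
   are irrelevant.  If I is a singleton then every function is differentiable
   on I, and derivative_on takes an unspecified value there. *)
Definition differentiable_on (R : realType) (I : set R) (f : R -> R) : Prop :=
  forall x, I x -> cvg ((f y - f x) / (y - x) @[y --> within I x^']).

Definition derivative_on (R : realType) (I : set R) (f : R -> R) (x : R) : R :=
  lim ((f y - f x) / (y - x) @[y --> within I x^']).

Definition positive_nondecreasing (R : realType) (K : nat)
    (lambda : nat -> R) : Prop :=
  (forall k, (k <= K)%N -> 0 < lambda k) /\
  (forall k, (k <= K - 1)%N -> lambda k <= lambda k.+1).

Definition subgradient_condition (R : realType) (K : nat) (I : set R)
    (t r : R -> R) (b lambda : nat -> R) : Prop :=
  positive_nondecreasing K lambda /\
  exists g : nat -> R, forall k, (k <= K - 1)%N ->
    subdifferential I r (b k) (g k) /\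
    (b k.+1 - b k) * (g k * t (b k)) >= -1 + 1 / lambda k.+1.

(* u = (log r)' s; log_derivativeE below shows u = r' t for r = s / t. *)
Definition log_derivative (R : realType) (I : set R) (s r : R -> R) (x : R) : R
  := derivative_on I (@ln R \o r) x * s x.

Definition derivative_condition (R : realType) (K : nat) (I : set R)
    (s r : R -> R) (b lambda : nat -> R) : Prop :=
  positive_nondecreasing K lambda /\
  differentiable_on I r /\
  forall k, (k <= K - 1)%N ->
    (b k.+1 - b k) * log_derivative I s r (b k) >= -1 + 1 / lambda k.+1.

Section LogDerivative.
Variables (R : realType) (I : set R) (x : R).
Hypothesis xI : limit_point I x.

Lemma within_dnbhs_proper : ProperFilter (within I x^').
Proof.
apply: Build_ProperFilter.
rewrite /within/= => h.
have [y [yx Iy Uy]] := xI h.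
exact: Uy.
Qed.

Lemma derivative_on_ln (f : R -> R) :
  0 < f x -> cvg ((f y - f x) / (y - x) @[y --> within I x^']) ->
  derivative_on I (@ln R \o f) x = derivative_on I f x / f x.
Proof.
move=> fx0 df.
have PF := within_dnbhs_proper.
pose psi (z : R) := if z == f x then (f x)^-1
  else (ln z - ln (f x)) / (z - f x).
have cpsi : psi z @[z --> f x] --> (f x)^-1.
  have -> : (f x)^-1 = psi (f x) by rewrite /psi eqxx.
  apply/continuous_withinNx; rewrite {2}/psi eqxx.
  have [dln eln] := is_derive1_ln fx0.
  have shift0 : z - f x @[z --> (f x)^'] --> (0 : R)^'.
    move=> P [e /= e0 eP]; exists e => //= z ze zfx.
    apply: eP; last by rewrite subr_eq0.
    by rewrite /= sub0r normrN distrC.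
  have := cvg_comp _ _ shift0 dln.
  rewrite -[lim _]/('D_1 (@ln R) (f x)) eln.
  apply: cvg_trans; apply: near_eq_cvg.
  near=> z.
  have zfx : z != f x by near: z; exact: nbhs_dnbhs_neq.
  by rewrite /= /psi (negbTE zfx) scaler1 subrK mulrC.
have cx : y @[y --> within I x^'] --> x.
  exact: cvg_trans (cvg_within I) (cvg_within _).
have cid : y - x @[y --> within I x^'] --> (0 : R).
  by rewrite -(subrr x); apply: cvgB => //; exact: cvg_cst.
have near_neq : \forall y \near within I x^', y != x.
  by exists 1 => //= y _ yx _.
have cf : f y @[y --> within I x^'] --> f x.
  have := cvgD (cvgM df cid) (cvg_cst (f x)).
  rewrite mulr0 add0r => /(_ _ _ _); apply: cvg_trans; apply: near_eq_cvg.
  near=> y.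
  have yx : y != x by near: y.
  by rewrite !fctE /= divfK ?subr_eq0// subrK.
apply/cvg_lim => //.
have /(_ _) := cvgM df (cvg_comp _ _ cf cpsi).
apply: cvg_trans; apply: near_eq_cvg.
near=> y.
have yx : y != x by near: y.
rewrite /= /psi; case: eqP => [->|/eqP fyx]; first by rewrite !subrr !mul0r.
by rewrite mulrC mulrA divfK// subr_eq0.
Unshelve. all: by end_near.
Qed.

Lemma log_derivativeE (s t : R -> R) : let r := fun y => s y / t y in
  0 < s x -> 0 < t x -> I x -> differentiable_on I r ->
  log_derivative I s r x = derivative_on I r x * t x.
Proof.
move=> r sx tx Ix dr.
rewrite /log_derivative derivative_on_ln ?divr_gt0//; last exact: dr.
by rewrite /r invf_div -mulrA divfK// gt_eqF.
Qed.
End LogDerivative.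

(* Main.v *)
(* The discrepancy a_k - lambda_k r(b_k) contracts by 1 - 1/s(b_k) at each step:
   since (1 - 1/s) r = r - 1/t, this reduces to
   r(b_{k+1}) >= r(b_k) + (1/lambda_{k+1} - 1)/t(b_k), which is the subgradient
   inequality at b_k combined with the step-size condition.  Case (b) is a case
   of (a), the derivative of a convex function on I being a subgradient;
   if b_{k+1} = b_k, however, I may be a singleton and its derivative_on
   meaningless, so there the bound is read off the step-size condition. *)
Require Import Defs.
From mathcomp Require Import all_boot all_order all_algebra.
From mathcomp Require Import all_classical all_reals all_analysis.
From mathcomp Require Import ring lra.
Import Order.TTheory GRing.Theory Num.Theory.
Import numFieldNormedType.Exports.
Local Open Scope classical_set_scope.
Local Open Scope ring_scope.

Lemma convex_function_segment {R : realType} {I : set R} {f : R -> R} {x y : R} (e : R) :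
  convex_function (I : set R^o) (f : R^o -> R^o) -> I x -> I y ->
  0 <= e <= 1 -> f (x + e * (y - x)) <= f x + e * (f y - f x).
Proof.
move=> cf Ix Iy /andP[e0 e1].
have := cf (Itv01 e0 e1) y x (mem_set Iy) (mem_set Ix).
rewrite !convRE/=.
congr (f _ <= _); rewrite /unstable.onem; last by ring.
by transitivity (e * y + (1 - e) * x); [|ring].
Qed.

Lemma is_interval_segment {R : realType} {I : set R} {x y e : R} :
  is_interval I -> I x -> I y -> 0 <= e <= 1 -> I (x + e * (y - x)).
Proof.
move=> itvI Ix Iy /andP[e0 e1].
by have [xy|/ltW yx] := leP x y; [apply: (itvI x y)|apply: (itvI y x)] => //;
  apply/andP; split; nra.
Qed.

(** For [e] in [(0, 1]] the point [x + e * (y - x)] stays in [I] and differs from [x]. A limit over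
    [I] at [x] thus becomes a limit in [e] along a segment, where convexity applies. *)
Lemma cvg_segment_within {R : realType} {I : set R} {x y : R} :
  is_interval I -> I x -> I y -> x != y ->
  x + e * (y - x) @[e --> 0^'+] --> within I x^'.
Proof.
move=> itvI Ix Iy xy U.
have yx0 : y - x != 0 by rewrite subr_eq0 eq_sym.
have cx : x + e * (y - x) @[e --> (0 : R)^'+] --> x.
  rewrite -[X in _ --> X]addr0 -[X in _ --> _ + X](mul0r (y - x)).
  apply: cvgD; first exact: cvg_cst.
  by apply: cvgMr_tmp; apply: cvg_within.
move=> /cx xU; change (\forall e \near 0^'+, U (x + e * (y - x))).
near=> e.
have e0 : 0 < e by near: e; exact: nbhs_right_gt.
have e1 : e <= 1 by near: e; exact: nbhs_right_le.
have: [set z | z != x -> I z -> U z] (x + e * (y - x)) by near: e.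
apply; last by apply: is_interval_segment; rewrite // ltW.
by rewrite -subr_eq0 addrC addKr mulf_neq0// gt_eqF.
Unshelve. all: by end_near.
Qed.

(** Supplies the hypothesis of [log_derivativeE]. Since [0^'+] is proper, some point of the segment
    from [x] to [y] has the required properties. *)
Lemma limit_point_interval {R : realType} {I : set R} {x y : R} :
  is_interval I -> I x -> I y -> x != y -> limit_point I x.
Proof.
move=> itvI Ix Iy xy U xU.
have V : within I x^' [set z | [/\ z != x, I z & U z]].
  move: xU; rewrite /within/= => -[d d0 dU].
  by exists d => //= z xz zx Iz; split => //; exact: dU.
have /filter_ex[e ?] : \forall e \near 0^'+,
    [set z | [/\ z != x, I z & U z]] (x + e * (y - x)).
  exact: cvg_segment_within itvI Ix Iy xy _ V.
by exists (x + e * (y - x)).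
Qed.

Lemma convex_derivative_subdifferential {R : realType} {I : set R}
    {f : R -> R} {x : R} :
  is_interval I -> convex_function (I : set R^o) (f : R^o -> R^o) -> I x ->
  cvg ((f y - f x) / (y - x) @[y --> within I x^']) ->
  subdifferential I f x (derivative_on I f x).
Proof.
move=> itvI cf Ix df y Iy.
have [<-|xy] := eqVneq x y; first by rewrite subrr mulr0 addr0.
have yx0 : y - x != 0 by rewrite subr_eq0 eq_sym.
have := cvg_comp _ _ (cvg_segment_within itvI Ix Iy xy) df.
rewrite -/(derivative_on I f x) => slope_cvg.
(* The limit is taken of slope times [y - x]: at [x + e * (y - x)] this is the increment of [f]
   divided by [e], so the sign of [y - x] never matters. *)
rewrite -lerBrDl.
apply: (cvgr_to_le (cvgM slope_cvg (cvg_cst (y - x)))).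
near=> e.
have e0 : 0 < e by near: e; exact: nbhs_right_gt.
have e1 : e <= 1 by near: e; exact: nbhs_right_le.
have /= := convex_function_segment e cf Ix Iy.
rewrite ltW// e1 => /(_ isT) fe.
rewrite /= [X in _ / X]addrAC subrr add0r invfM mulrA divfK// ler_pdivrMr//.
by rewrite lerBlDl [_ * e]mulrC.
Unshelve. all: by end_near.
Qed.

(** Here [sk / tk] is the current value of [r], and [d] a lower bound on its increment. Multiplying
    the bound on [d * tk] by [l1 / tk] absorbs the [1 / tk] of the recursion. *)
Lemma potential_step {R : realType} {a a1 sk tk r1 l l1 d : R} :
  1 <= sk -> 0 < tk -> 0 < l1 -> l <= l1 ->
  a1 <= (1 - 1 / sk) * a + 1 / tk ->
  -1 + 1 / l1 <= d * tk -> sk / tk + d <= r1 ->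
  a1 - l1 * r1 <= (1 - 1 / sk) * (a - l * (sk / tk)).
Proof.
move=> s1 t0 l10 ll ha hd hr.
have s0 : 0 < sk by exact: lt_le_trans s1.
have hd' : 1 / tk - l1 / tk <= l1 * d.
  rewrite -mulrBl ler_pdivrMr// -mulrA.
  have := ler_wpM2l (ltW l10) hd.
  by rewrite mulrDr mulrN1 mulrCA divff ?gt_eqF// mulr1 addrC.
have hr' : l1 * (sk / tk) + l1 * d <= l1 * r1.
  by rewrite -mulrDr ler_wpM2l// ltW.
(* Replacing [l] by the larger [l1] is sound because [sk >= 1] makes its coefficient nonnegative. *)
have hl : l * ((sk - 1) / tk) <= l1 * ((sk - 1) / tk).
  by rewrite ler_wpM2r// divr_ge0 ?subr_ge0// ltW.
have -> : (1 - 1 / sk) * (a - l * (sk / tk)) =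
    (1 - 1 / sk) * a - l * ((sk - 1) / tk).
  by field; rewrite !gt_eqF.
have eq1 : l1 * ((sk - 1) / tk) = l1 * (sk / tk) - l1 / tk by field; rewrite gt_eqF.
lra.
Qed.

Theorem theorem2p1 (R : realType) (K : nat) (hK : (1 <= K)%N)
    (a b : nat -> R) (s t : R -> R)
    (hrec : forall k : nat, (k <= K)%N ->
       a k.+1 <= (1 - 1 / s (b k)) * a k + 1 / t (b k))
    (I : set R) (hI : is_interval I)
    (hb : forall k : nat, (k <= K)%N -> I (b k))
    (hs : forall x : R, I x -> 1 <= s x)
    (ht : forall x : R, I x -> 0 < t x)
    (r : R -> R) (hr : r = fun x => s x / t x)
    (hconv : convex_function (I : set R^o) (r : R^o -> R^o))
    (lambda : nat -> R)
    (hab : subgradient_condition K I t r b lambda \/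
           derivative_condition K I s r b lambda) :
  forall k : nat, (k <= K - 1)%N ->
    a k.+1 <= lambda k.+1 * r (b k.+1) +
      (a 0%N - lambda 0%N * r (b 0%N)) *
        \prod_(0 <= i < k.+1) (1 - 1 / s (b i)).
Proof.
have ltK k : (k <= K - 1)%N -> (k < K)%N by rewrite -ltnS subn1 prednK.
have [lambda_gt0 lambda_nd] : positive_nondecreasing K lambda.
  by case: hab => -[].
(* [d] is a subgradient times [b k.+1 - b k], or [0] if the two points coincide; (a) and (b) are not
   distinguished afterwards. *)
have increment k : (k <= K - 1)%N -> exists2 d : R,
    -1 + 1 / lambda k.+1 <= d * t (b k) & r (b k) + d <= r (b k.+1).
  move=> kK; have [Ib Ib1] := (hb _ (ltnW (ltK _ kK)), hb _ (ltK _ kK)).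
  case: hab => [[_ [g /(_ _ kK)[gk hk]]]|[_ [dr /(_ _ kK) hk]]].
    exists (g k * (b k.+1 - b k)); last exact: gk.
    by rewrite -mulrA mulrCA.
  have [bE|bN] := eqVneq (b k) (b k.+1).
    by exists 0; rewrite ?bE ?addr0// mul0r; move: hk; rewrite bE subrr mul0r.
  exists (derivative_on I r (b k) * (b k.+1 - b k)).
    rewrite -mulrA mulrCA; move: hk; rewrite hr log_derivativeE.
    - by [].
    - exact: limit_point_interval bN.
    - exact: lt_le_trans (hs _ Ib).
    - exact: ht.
    - by [].
    - by rewrite -hr.
  exact: (convex_derivative_subdifferential hI hconv Ib (dr _ Ib)).
have step k : (k <= K - 1)%N -> a k.+1 - lambda k.+1 * r (b k.+1) <=
    (1 - 1 / s (b k)) * (a k - lambda k * r (b k)).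
  move=> kK; have Ib := hb _ (ltnW (ltK _ kK)).
  have [d hd hrd] := increment _ kK.
  rewrite [in leRHS]hr; apply: (potential_step _ _ _ _ _ hd).
  - exact: hs.
  - exact: ht.
  - exact/lambda_gt0/ltK.
  - exact: lambda_nd.
  - exact/hrec/ltnW/ltK.
  - by move: hrd; rewrite {1}hr.
move=> k kK; rewrite -lerBlDl.
elim: k kK => [|k IHk] kK; first by rewrite big_nat1 [leRHS]mulrC step.
apply: le_trans (step _ kK) _.
(* The induction hypothesis may be multiplied by [1 - 1 / s (b k.+1)], which is nonnegative as
   [s >= 1] on [I]. *)
rewrite big_nat_recr//= mulrA [leRHS]mulrC ler_wpM2l ?IHk ?(ltnW kK)//.
have s1 := hs _ (hb _ (ltnW (ltK _ kK))).
by rewrite subr_ge0 ler_pdivrMr ?mul1r// (lt_le_trans ltr01).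
Qed.
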